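(* For any non-zero $x$ in $\mathbb{E}=S/B$, there is an element $x^{-1}\in\mathbb{E}$ such that $x x^{-1}=1^{\mathbb{E}}$. Thus the commutative ring $\mathbb{E}$ is a field.
   Context: A function $f:\mathbb{Z}\to\mathbb{Z}$ is an almost homomorphism iff the function $d_f(p,q)=f(p+q)-f(p)-f(q)$ from $\mathbb{Z}\times\mathbb{Z}$ to $\mathbb{Z}$ has bounded range, i.e. for some integer $C$, $|d_f(p,q)|<C$ for all $p,q\in\mathbb{Z}$. $S$ is the abelian group of all almost homomorphisms $\mathbb{Z}\to\mathbb{Z}$ under pointwise addition, and $B$ is the subgroup of all functions $\mathbb{Z}\to\mathbb{Z}$ with bounded range. The abelian group of Eudoxus reals is the quotient $\mathbb{E}=S/B$; $[f]$ denotes the class of $f\in S$. $\mathbb{E}$ is a commutative ring with unit under the multiplication $[f][g]=[f\circ g]$, with unit $1^{\mathbb{E}}=[p\mapsto p]$. *)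

(* Defs.v *)
From HB Require Import structures.
From mathcomp Require Import all_boot all_order all_algebra.
From mathcomp Require Import ring lra zify.
From mathcomp Require Import boolp functions.

Set Implicit Arguments.
Unset Strict Implicit.
Unset Printing Implicit Defensive.

Import Order.TTheory GRing.Theory Num.Theory.
Local Open Scope ring_scope.
Local Open Scope quotient_scope.

Definition bounded_range (T : Type) (g : T -> int) : Prop :=
  exists C : int, forall t, `|g t| < C.

Definition defect (f : int -> int) (pq : int * int) : int :=
  f (pq.1 + pq.2) - f pq.1 - f pq.2.

Definition almost_hom (f : int -> int) : Prop := bounded_range (defect f).

Lemma bounded_range0 (T : Type) : bounded_range (fun _ : T => 0).
Proof. by exists 1 => t; rewrite normr0. Qed.

Lemma bounded_rangeB (T : Type) (g h : T -> int) :
  bounded_range g -> bounded_range h -> bounded_range (fun t => g t - h t).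
Proof.
move=> [C HC] [D HD]; exists (C + D) => t.
by have := HC t; have := HD t; lia.
Qed.

Lemma bounded_rangeN (T : Type) (g : T -> int) :
  bounded_range g -> bounded_range (fun t => - g t).
Proof. by move=> [C HC]; exists C => t; rewrite normrN. Qed.

Lemma bounded_rangeD (T : Type) (g h : T -> int) :
  bounded_range g -> bounded_range h -> bounded_range (fun t => g t + h t).
Proof.
move=> [C HC] [D HD]; exists (C + D) => t.
by have := HC t; have := HD t; lia.
Qed.

Lemma bounded_range_eq (T : Type) (g h : T -> int) :
  g =1 h -> bounded_range g -> bounded_range h.
Proof. by move=> e [C HC]; exists C => t; rewrite -e. Qed.

Lemma bounded_range_comp (T U : Type) (g : T -> int) (k : U -> T) :
  bounded_range g -> bounded_range (fun u => g (k u)).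
Proof. by move=> [C HC]; exists C => u; exact: HC. Qed.

Lemma almost_hom_mul (f : int -> int) (C : int) :
  (forall p q : int, `|f (p + q) - f p - f q| < C) ->
  forall n p : int, `|f (n * p) - n * f p| <= (`|n| + 1) * C.
Proof.
move=> HC n p.
have up (u v w b M : int) :
  `|u - b| <= M -> `|v - u - w| < C -> `|v - (b + w)| <= M + C by lia.
have down (u v w b M : int) :
  `|u - b| <= M -> `|u - v - w| < C -> `|v - (b - w)| <= M + C by lia.
elim: n => [|n IH|n IH].
- by have := HC 0 0; rewrite !mul0r addr0 normr0 add0r mul1r; move: (f 0); lia.
- have -> : n.+1%:Z * f p = n%:Z * f p + f p by rewrite intS; ring.
  have -> : (`|n.+1%:Z| + 1) * C = (`|n%:Z| + 1) * C + C.
    by rewrite !ger0_norm // intS; ring.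
  apply: up IH _.
  have -> : n.+1%:Z * p = n%:Z * p + p by rewrite intS; ring.
  exact: HC.
- have -> : - n.+1%:Z * f p = - n%:Z * f p - f p by rewrite intS; ring.
  have -> : (`|- n.+1%:Z| + 1) * C = (`|- n%:Z| + 1) * C + C.
    by rewrite !normrN !ger0_norm // intS; ring.
  apply: down IH _.
  have -> : - n%:Z * p = - n.+1%:Z * p + p by rewrite intS; ring.
  exact: HC.
Qed.

Lemma almost_hom_lin (f : int -> int) : almost_hom f ->
  exists A, forall p : int, `|f p| <= A * (`|p| + 1).
Proof.
move=> [C HC]; have HC' (p q : int) : `|f (p + q) - f p - f q| < C := HC (p, q).
exists (C + `|f 1|) => p.
by have := almost_hom_mul HC' p 1; rewrite mulr1; nia.
Qed.

Lemma almost_hom_bounded (T : Type) (f : int -> int) (g : T -> int) :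
  almost_hom f -> bounded_range g -> bounded_range (fun t => f (g t)).
Proof.
move=> /almost_hom_lin[A HA] [C HC].
exists (A * (C + 1) + 1) => t; have := HA (g t); have := HC t.
by have := normr_ge0 (f (g t)); nia.
Qed.

Lemma almost_hom_compD (T : Type) (f : int -> int) (g h : T -> int) :
  almost_hom f -> bounded_range (fun t => f (g t + h t) - f (g t) - f (h t)).
Proof. exact: (@bounded_range_comp _ T (defect f) (fun t => (g t, h t))). Qed.

Lemma almost_hom_compB (T : Type) (f : int -> int) (g h : T -> int) :
  almost_hom f -> bounded_range (fun t => g t - h t) ->
  bounded_range (fun t => f (g t) - f (h t)).
Proof.
move=> Hf Hgh.
have H1 := almost_hom_bounded Hf Hgh.
have H2 := almost_hom_compD (fun t => g t - h t) h Hf.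
apply: bounded_range_eq (bounded_rangeD H2 H1) => t /=.
by rewrite subrK; ring.
Qed.

Lemma almost_hom_comp (f g : int -> int) :
  almost_hom f -> almost_hom g -> almost_hom (f \o g).
Proof.
move=> Hf Hg.
have H1 := @almost_hom_compB (int * int) f (fun pq => g (pq.1 + pq.2))
   (fun pq => g pq.1 + g pq.2) Hf.
have {}H1 := H1 (bounded_range_eq _ Hg).
have H2 := @almost_hom_compD (int * int) f (fun pq => g pq.1)
  (fun pq => g pq.2) Hf.
have {}H1 := H1 (fun pq => ltac:(rewrite /defect; ring)).
apply: bounded_range_eq (bounded_rangeD H1 H2) => -[p q].
by rewrite /defect /=; ring.
Qed.

Lemma almost_hom_commute (f g : int -> int) :
  almost_hom f -> almost_hom g -> bounded_range (fun p => f (g p) - g (f p)).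
Proof.
move=> Hf Hg.
have [A HA] := almost_hom_lin Hf; have [B HB] := almost_hom_lin Hg.
case: Hf => C HC;
  have {}HC (p q : int) : `|f (p + q) - f p - f q| < C := HC (p, q).
case: Hg => D HD;
  have {}HD (p q : int) : `|g (p + q) - g p - g q| < D := HD (p, q).
pose M := (1 + 2 * 1) * C + (1 + 2 * B) * C
          + ((1 + 2 * 1) * D + (1 + 2 * A) * D).
exists (M + `|f (g 0) - g (f 0)| + 1) => p.
have A0 : 0 <= A.
  by have := HA 0; rewrite normr0 add0r mulr1; exact: le_trans.
have B0 : 0 <= B.
  by have := HB 0; rewrite normr0 add0r mulr1; exact: le_trans.
have C0 : 0 <= C by exact: le_trans (ltW (HC 0 0)).
have D0 : 0 <= D by exact: le_trans (ltW (HD 0 0)).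
have M0 : 0 <= M by rewrite /M !(addr_ge0, mulr_ge0).
have [->|p0] := eqVneq p 0.
  by apply: ltr_pwDr => //; rewrite lerDr.
have p1 : 1 <= `|p| by rewrite -gtz0_ge1 normr_gt0.
have aux (u K L : int) : u <= K * (`|p| + 1) -> 0 <= K -> 0 <= L ->
    (u + 1) * L <= `|p| * ((1 + 2 * K) * L).
  move=> uK K0 L0; rewrite mulrA ler_wpM2r //.
  have KP : K * 1 <= K * `|p| by rewrite ler_wpM2l.
  have -> : `|p| * (1 + 2 * K) = `|p| + K * `|p| + K * `|p| by ring.
  move: uK KP p1; rewrite mulrDr mulr1.
  by move: (K * `|p|) `|p| => a b; clear; lia.
have F1 := almost_hom_mul HC p (g p).
have F2 := almost_hom_mul HC (g p) p.
have G1 := almost_hom_mul HD p (f p).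
have G2 := almost_hom_mul HD (f p) p.
have P1 : `|p| <= 1 * (`|p| + 1) by rewrite mul1r lerDl.
have b1 := aux _ _ _ P1 ler01 C0.
have b2 := aux _ _ _ (HB p) B0 C0.
have b3 := aux _ _ _ P1 ler01 D0.
have b4 := aux _ _ _ (HA p) A0 D0.
have tri (c1 c2 c3 c4 a1 a2 x y z : int) :
    `|a1 - x| <= c1 -> `|a1 - z| <= c2 -> `|a2 - y| <= c3 -> `|a2 - z| <= c4 ->
    `|x - y| <= c1 + c2 + (c3 + c4) by clear; lia.
have E1 : `|p * f (g p) - p * g (f p)| <= `|p| * M.
  rewrite (mulrC (g p) p) in F2; rewrite (mulrC (f p) p) (mulrC (f p)) in G2.
  apply: le_trans (tri _ _ _ _ _ _ _ _ _ F1 F2 G1 G2) _.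
  by rewrite /M !(mulrDr `|p|) !lerD.
have E3 : `|f (g p) - g (f p)| <= M.
  by rewrite -(ler_pM2l (x := `|p|)) ?normr_gt0 // -normrM mulrBr.
by apply: le_lt_trans E3 _; rewrite -addrA ltrDl ltr_wpDl.
Qed.

Definition is_almost_hom : {pred int -> int} := fun f => `[< almost_hom f >].

Lemma is_almost_hom_zmod : zmod_closed is_almost_hom.
Proof.
split=> [|f g /asboolP Hf /asboolP Hg]; apply/asboolP.
  by apply: bounded_range_eq (@bounded_range0 (int * int)) => -[p q].
apply: bounded_range_eq (bounded_rangeB Hf Hg) => -[p q].
by rewrite /defect /= !fctE; ring.
Qed.

HB.instance Definition _ :=
  GRing.isZmodClosed.Build (int -> int) is_almost_hom is_almost_hom_zmod.

Record AlmostHom := MkAlmostHom {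
  AlmostHom_fun :> int -> int;
  AlmostHom_funP : is_almost_hom AlmostHom_fun }.

HB.instance Definition _ := [isSub for AlmostHom_fun].
HB.instance Definition _ := [Choice of AlmostHom by <:].
HB.instance Definition _ := [SubChoice_isSubZmodule of AlmostHom by <:].

Lemma AlmostHomP (f : AlmostHom) : almost_hom f.
Proof. exact/asboolP/(AlmostHom_funP f). Qed.

(* Every function of bounded range is an almost homomorphism, so the subgroup
   [Bounded] of [AlmostHom] contains all of them (see [bounded_almost_hom]). *)
Definition Bounded : {pred AlmostHom} :=
  fun f => `[< bounded_range (AlmostHom_fun f) >].

Lemma bounded_almost_hom (f : int -> int) : bounded_range f -> almost_hom f.
Proof.
move=> Hf; have H (k : int * int -> int) := bounded_range_comp k Hf.
exact: bounded_rangeB (bounded_rangeB (H _) (H fst)) (H snd).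
Qed.

Lemma Bounded_zmod : zmod_closed Bounded.
Proof.
split=> [|f g /asboolP Hf /asboolP Hg]; apply/asboolP.
  exact: bounded_range0.
exact: bounded_rangeB.
Qed.

HB.instance Definition _ :=
  GRing.isZmodClosed.Build AlmostHom Bounded Bounded_zmod.

Definition Eudoxus : Type := Quotient.quot Bounded.

HB.instance Definition _ := GRing.Zmodule.on Eudoxus.
HB.instance Definition _ := EqQuotient.on Eudoxus.

Lemma Eudoxus_eqP (f g : AlmostHom) :
  reflect (bounded_range (fun p => f p - g p))
    (\pi_Eudoxus f == \pi_Eudoxus g).
Proof. by rewrite -(Quotient.idealrBE Bounded f g); exact: asboolP. Qed.

Lemma AlmostHom_id_subproof : is_almost_hom id.
Proof.
apply/asboolP; apply: bounded_range_eq (@bounded_range0 (int * int)) => -[p q].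
by rewrite /defect /=; ring.
Qed.

Definition AlmostHom_id : AlmostHom := MkAlmostHom AlmostHom_id_subproof.

Lemma AlmostHom_comp_subproof (f g : AlmostHom) : is_almost_hom (f \o g).
Proof. by apply/asboolP/almost_hom_comp; exact: AlmostHomP. Qed.

Definition AlmostHom_comp (f g : AlmostHom) : AlmostHom :=
  MkAlmostHom (AlmostHom_comp_subproof f g).

Definition Eudoxus_one : Eudoxus := \pi_Eudoxus AlmostHom_id.

(* The product is the class of the composite of canonical representatives;
   [Eudoxus_mulE] shows that any representatives give the same class. *)
Definition Eudoxus_mul (x y : Eudoxus) : Eudoxus :=
  \pi_Eudoxus (AlmostHom_comp (repr x) (repr y)).

Lemma Eudoxus_mulE (f g : AlmostHom) :
  Eudoxus_mul (\pi_Eudoxus f) (\pi_Eudoxus g)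
  = \pi_Eudoxus (AlmostHom_comp f g).
Proof.
apply/eqP/Eudoxus_eqP => /=.
have /eqP/Eudoxus_eqP Hf :
  \pi_Eudoxus (repr (\pi_Eudoxus f)) = \pi_Eudoxus f by rewrite reprK.
have /eqP/Eudoxus_eqP Hg :
  \pi_Eudoxus (repr (\pi_Eudoxus g)) = \pi_Eudoxus g by rewrite reprK.
have H1 := almost_hom_compB (AlmostHomP f) Hg.
have H2 := bounded_range_comp (repr (\pi_Eudoxus g)) Hf.
by apply: bounded_range_eq (bounded_rangeD H1 H2) => p /=; ring.
Qed.

Lemma Eudoxus_mulA : associative Eudoxus_mul.
Proof.
elim/quotW=> f; elim/quotW=> g; elim/quotW=> h.
rewrite (Eudoxus_mulE g h) (Eudoxus_mulE f g) (Eudoxus_mulE f _)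
  (Eudoxus_mulE _ h).
by congr \pi_Eudoxus; apply: val_inj.
Qed.

Lemma Eudoxus_mulC : commutative Eudoxus_mul.
Proof.
elim/quotW=> f; elim/quotW=> g; rewrite (Eudoxus_mulE f g) (Eudoxus_mulE g f).
apply/eqP/Eudoxus_eqP.
exact: almost_hom_commute (AlmostHomP f) (AlmostHomP g).
Qed.

Lemma Eudoxus_mul1 : left_id Eudoxus_one Eudoxus_mul.
Proof.
by elim/quotW=> f; rewrite (Eudoxus_mulE AlmostHom_id f);
  congr \pi_Eudoxus; apply: val_inj.
Qed.

Lemma Eudoxus_addE (f g : AlmostHom) :
  (\pi_Eudoxus f : Eudoxus) + \pi_Eudoxus g = \pi_Eudoxus (f + g).
Proof.
exact/esym/(@pi_addr AlmostHom (Quotient.equiv Bounded) 0 -%R +%R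
  (Quotient.quot Bounded)).
Qed.

Lemma Eudoxus_mulDl : left_distributive Eudoxus_mul +%R.
Proof.
elim/quotW=> f; elim/quotW=> g; elim/quotW=> h.
rewrite Eudoxus_addE (Eudoxus_mulE f h) (Eudoxus_mulE g h)
  (Eudoxus_mulE (f + g) h) Eudoxus_addE.
by congr \pi_Eudoxus; apply: val_inj.
Qed.

(* [comPzRingType] does not include 1 != 0. *)
HB.instance Definition _ :=
  GRing.Zmodule_isComPzRing.Build Eudoxus Eudoxus_mulA Eudoxus_mulC
  Eudoxus_mul1 Eudoxus_mulDl.

(* Main.v *)
Require Import Defs.
From mathcomp Require Import all_boot all_order all_algebra.
From HB Require Import structures.
From mathcomp Require Import ring zify.
From mathcomp Require Import boolp.

(** An almost homomorphism behaves, up to bounded error, like a line through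
the origin; being non-zero in [Eudoxus] means that this line is not horizontal,
and the inverse class is that of the line reflected in the diagonal.

No slope is ever computed.  Suppose that [f] has defect less than [C] and takes
some value [f p] with [C <= `|f p|], as every unbounded [f] does.
- Moving the argument by [p] then moves the value of [f] in a known direction
  by an amount between [1] and [`|f p| + C].  So from any argument one can step
  towards any target [t] until [f d] is within [`|f p| + C] of [t]: the range
  of [f] meets every long enough interval ([almost_hom_coarsely_onto]).  Choosing
  such a [d] for each [t] gives a function [g] with [f \o g] at bounded
  distance from the identity.
- [f] is proper: [f n] and [n] are bounded in terms of each other
  ([almost_hom_proper]).  Up to bounded error [f] sends the defect of [g] to
  the defect of [f \o g], which is bounded; by properness the defect of [g] is
  bounded as well, that is, [g] is an almost homomorphism
  ([almost_hom_section]).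

The class of [g] is the inverse of the class of [f].  For the second half of
the theorem, the inverses are chosen classically and the field structure
is built over the existing ring operations, so that forgetting it gives back
the original ring by computation. *)

Set Implicit Arguments.
Unset Strict Implicit.
Unset Printing Implicit Defensive.

Import Order.TTheory GRing.Theory Num.Theory.
Local Open Scope ring_scope.
Local Open Scope quotient_scope.

Lemma unbounded_range_ge (T : Type) (f : T -> int) (C : int) :
  ~ bounded_range f -> exists t, C <= `|f t|.
Proof.
move=> fU; apply: contrapT => noT; apply: fU; exists C => t.
by rewrite ltNge; apply/negP => Ct; apply: noT; exists t.
Qed.

(** Comparing [f (n * p)] with both [n * f p] and [p * f n] shows that
[p * f n] and [n * f p] differ by at most [(`|n| + `|p| + 2) * C].  When
[`|f p|] exceeds [C], the term [`|n| * C] is absorbed by [`|n| * `|f p|], which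
leaves a bound for [`|n|] that is linear in [`|f n|]. *)
Lemma almost_hom_proper (T : Type) (f : int -> int) (h : T -> int) :
  almost_hom f -> ~ bounded_range f ->
  bounded_range (fun t => f (h t)) -> bounded_range h.
Proof.
move=> [C HC] fU [M HM].
have {}HC (p q : int) : `|f (p + q) - f p - f q| < C := HC (p, q).
have [p Hp] := unbounded_range_ge (C + 1) fU.
exists (`|p| * M + (`|p| + 2) * C + 1) => t.
set n := h t; have {}HM : `|f n| < M := HM t.
have H1 := almost_hom_mul HC n p; have H2 := almost_hom_mul HC p n.
have H3 : `|n * f p| <= `|p * f n| + (`|n| + 1) * C + (`|p| + 1) * C.
  have tri (a x y u v : int) :
    `|a - x| <= u -> `|a - y| <= v -> `|x| <= `|y| + u + v by clear; lia.
  by apply: tri H1 _; rewrite (mulrC n p).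
have H4 : `|n| * (C + 1) <= `|n| * `|f p| by rewrite ler_wpM2l.
have H5 : `|p| * `|f n| <= `|p| * M by rewrite ler_wpM2l // ltW.
have : `|n| * (C + 1) <= `|p| * M + (`|n| + 1) * C + (`|p| + 1) * C.
  apply: le_trans H4 _; rewrite -normrM; apply: le_trans H3 _.
  by rewrite !lerD2r normrM.
by clear; rewrite !mulrDl !mulrDr; lia.
Qed.

(** Adding or subtracting a [p] with [C <= `|f p|] changes the value of [f] by
at least [1] and less than [`|f p| + C].  So as long as [f d] is at least
[`|f p| + C] away from [t], one of the two moves brings it strictly closer
without overshooting, and the descent on the distance stops. *)
Lemma almost_hom_coarsely_onto (f : int -> int) :
  almost_hom f -> ~ bounded_range f ->
  exists K : int, forall t, exists d, `|f d - t| < K.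
Proof.
move=> [C HC] fU.
have {}HC (p q : int) : `|f (p + q) - f p - f q| < C := HC (p, q).
have [p Hp] := unbounded_range_ge C fU.
exists (`|f p| + C) => t.
suff descend k : forall d : int, (`|f d - t| < k)%N ->
    exists d' : int, `|f d' - t| < `|f p| + C by exact: descend _ 0 (ltnSn _).
elim: k => // k IH d Hd.
have [|far] := ltP `|f d - t| (`|f p| + C); first by exists d.
have up := HC d p; have down := HC (d - p) p; rewrite subrK in down.
(* Whether [d + p] or [d - p] brings the value closer to [t] depends on
   whether [f p] and [t - f d] have the same sign. *)
have [closer|closer] : (`|(f (d + p) - t)%R| < `|f d - t|)%N \/
    (`|(f (d - p) - t)%R| < `|f d - t|)%N.
  by move: Hp far up down; clear; lia.
all: by apply: IH (leq_trans closer _).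
Qed.

(** Up to bounded error, [f] maps the defect of [g] to the defect of
[f \o g], and the latter is bounded because [f \o g] is close to the identity;
properness of [f] brings the bound back to the defect of [g] itself. *)
Lemma almost_hom_section (f g : int -> int) :
  almost_hom f -> ~ bounded_range f ->
  bounded_range (fun t => f (g t) - t) -> almost_hom g.
Proof.
move=> Hf fU Hfg; apply: (almost_hom_proper Hf fU).
have D1 := almost_hom_compD (fun pq : int * int => defect g pq + g pq.1)
  (fun pq => g pq.2) Hf.
have D2 := almost_hom_compD (fun pq : int * int => defect g pq)
  (fun pq => g pq.1) Hf.
have F0 := bounded_range_comp (fun pq : int * int => pq.1 + pq.2) Hfg.
have F1 := bounded_range_comp (@fst int int) Hfg.
have F2 := bounded_range_comp (@snd int int) Hfg.
have := bounded_rangeB F0 (bounded_rangeD (bounded_rangeD F1 F2)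
  (bounded_rangeD D1 D2)).
apply: bounded_range_eq => -[p q] /=.
have -> : defect g (p, q) + g p + g q = g (p + q) by rewrite /defect /=; ring.
by ring.
Qed.

Lemma Eudoxus_eq0P (f : AlmostHom) :
  reflect (bounded_range f) (\pi_Eudoxus f == 0).
Proof.
have -> : (0 : Eudoxus) = \pi_Eudoxus 0.
  exact/esym/(@pi_zeror AlmostHom (Quotient.equiv Bounded) 0 -%R +%R
    (Quotient.quot Bounded)).
have f0 : (fun p => f p - AlmostHom_fun 0 p) =1 f by move=> p; rewrite subr0.
apply: (iffP (Eudoxus_eqP f 0)); first exact: bounded_range_eq.
by apply: bounded_range_eq => p; rewrite f0.
Qed.

Lemma Eudoxus_has_inverse (x : Eudoxus) :
  x <> 0 -> exists y : Eudoxus, x * y = 1.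
Proof.
elim/quotW: x => f /eqP/Eudoxus_eq0P fU.
have [K /choice[g Hg]] := almost_hom_coarsely_onto (AlmostHomP f) fU.
have Hfg : bounded_range (fun t => f (g t) - t) by exists K.
have gH : is_almost_hom g.
  exact/asboolP/(almost_hom_section (AlmostHomP f) fU Hfg).
exists (\pi_Eudoxus (MkAlmostHom gH)).
rewrite [LHS](Eudoxus_mulE f (MkAlmostHom gH)).
exact/eqP/Eudoxus_eqP.
Qed.

Lemma Eudoxus_1_neq0 : (1 : Eudoxus) != 0.
Proof.
by apply/Eudoxus_eq0P => -[C /(_ C)] /=; lia.
Qed.

HB.instance Definition _ :=
  GRing.PzSemiRing_isNonZero.Build Eudoxus Eudoxus_1_neq0.

Lemma Eudoxus_inv_exists (x : Eudoxus) :
  exists y : Eudoxus, (x != 0 -> y * x = 1) /\ (x = 0 -> y = 0).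
Proof.
have [->|/eqP x0] := eqVneq x 0; first by exists 0.
by have [y xy] := Eudoxus_has_inverse x0; exists y; rewrite mulrC.
Qed.

Definition Eudoxus_inv (x : Eudoxus) : Eudoxus :=
  projT1 (cid (Eudoxus_inv_exists x)).

Lemma Eudoxus_mulVx (x : Eudoxus) : x != 0 -> Eudoxus_inv x * x = 1.
Proof. by rewrite /Eudoxus_inv; case: cid => y []. Qed.

Lemma Eudoxus_inv0 : Eudoxus_inv 0 = 0.
Proof. by rewrite /Eudoxus_inv; case: cid => y /= Hy; exact: Hy.2. Qed.

HB.instance Definition _ :=
  GRing.ComNzRing_isField.Build Eudoxus Eudoxus_mulVx Eudoxus_inv0.

Theorem theorem11 :
  (forall x : Eudoxus, x <> 0 -> exists y : Eudoxus, x * y = 1) /\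
  (exists F : fieldType, (F : comPzRingType) = (Eudoxus : comPzRingType)).
Proof. by split; [exact: Eudoxus_has_inverse | exists Eudoxus]. Qed.
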